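(* Let $\Gamma$ be a quasi-finite, free EI-category. Then the homomorphisms $\overline{\omega}^{(2)},\overline{\mu}^{(2)}\colon U(\Gamma)\otimes_{\mathbb{Z}}\mathbb{Q}\to U(\Gamma)\otimes_{\mathbb{Z}}\mathbb{Q}$ are isomorphisms and inverse to one another.
   Context: An EI-category is a small category in which every endomorphism is an isomorphism. $\mathrm{iso}(\Gamma)$ is the set of isomorphism classes $\overline{x}$ of objects, with fixed representatives $x$; $\overline{x}\le\overline{y}$ iff $\mathrm{mor}(x,y)\ne\emptyset$ (a partial order). $\Gamma$ is quasi-finite if each set $\{\overline{y}\mid\overline{y}\le\overline{x}\}$ is finite and each right $\mathrm{aut}(x)$-set $\mathrm{mor}(x,y)$ is proper (finite isotropy groups) and cofinite (finitely many orbits). $\Gamma$ is free if for all objects $x,y$ the left $\mathrm{aut}(y)$-action on $\mathrm{mor}(x,y)$ is free. $U(\Gamma)$ is the free abelian group on $\mathrm{iso}(\Gamma)$. For $l\ge1$, $\mathrm{ch}_l(y,x)$ is the set of chains $c=(\overline{x_0}<\cdots<\overline{x_l})$ in $\mathrm{iso}(\Gamma)$ with $\overline{x_0}=\overline{y}$, $\overline{x_l}=\overline{x}$, and $S(c)$ is the $\mathrm{aut}(x)$-$\mathrm{aut}(y)$-biset $\mathrm{mor}(x_{l-1},x)\times_{\mathrm{aut}(x_{l-1})}\mathrm{mor}(x_{l-2},x_{l-1})\times_{\mathrm{aut}(x_{l-2})}\cdots\times_{\mathrm{aut}(x_1)}\mathrm{mor}(y,x_1)$. $\mathrm{ch}_0(y,x)$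 has one element $c$, with $S(c)=\mathrm{mor}(x,x)$, if $\overline{x}=\overline{y}$, and is empty otherwise. $\mathcal{N}(y)=\mathcal{N}(\mathrm{aut}(y))$ is the group von Neumann algebra and $\dim_{\mathcal{N}(y)}$ its (L\''uck) dimension function; $\mathbb{Q}[y]=\mathbb{Q}[\mathrm{aut}(y)]$. For a proper cofinite right $\mathrm{aut}(y)$-set $T\cong\coprod_{i=1}^rL_i\backslash\mathrm{aut}(y)$ (all $L_i$ finite), $\dim_{\mathcal{N}(y)}(\mathbb{Q}T\otimes_{\mathbb{Q}[y]}\mathcal{N}(y))=\sum_{i=1}^r1/|L_i|$. The sets $\mathrm{mor}(y,x)$ and $S(c)$ are proper cofinite right $\mathrm{aut}(y)$-sets. $\overline{\omega}^{(2)}$ is given by the rational matrix with $(\overline{x},\overline{y})$-entry (the component from the $\overline{x}$-summand to the $\overline{y}$-summand) $\dim_{\mathcal{N}(y)}(\mathbb{Q}\,\mathrm{mor}(y,x)\otimes_{\mathbb{Q}[y]}\mathcal{N}(y))$. $\overline{\mu}^{(2)}$ is given by the rational matrix with $(\overline{x},\overline{y})$-entry $\sum_{l\ge0}(-1)^l\sum_{c\in\mathrm{ch}_l(y,x)}\dim_{\mathcal{N}(y)}(\mathbb{Q}S(c)\otimes_{\mathbb{Q}[y]}\mathcal{N}(y))$. *)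

(* Defs.v *)
From HB Require Import structures.
From mathcomp Require Import all_boot all_order all_algebra.
From mathcomp Require Import generic_quotient ring_quotient.
From mathcomp Require Import all_classical all_reals.
From mathcomp Require Import ereal esum complex freeg.
From mathcomp Require Import ring.

Set Implicit Arguments.
Unset Strict Implicit.
Unset Printing Implicit Defensive.

Import Order.TTheory GRing.Theory Num.Theory Normc.

Local Open Scope classical_set_scope.
Local Open Scope quotient_scope.
Local Open Scope ring_scope.

Lemma fglift_linear (A : nzRingType) (K : choiceType) (M : lmodType A)
  (f : K -> M) : linear (fglift f).
Proof.
have lB u v : fglift f (u - v) = fglift f u - fglift f v.
  exact: lift_is_additive.
have l0 : fglift f 0 = 0 by have := lB 0 0; rewrite !subrr.
have lD u v : fglift f (u + v) = fglift f u + fglift f v.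
  by rewrite -[in LHS](opprK v) lB -sub0r lB l0 sub0r opprK.
have lsum (s : seq K) (F : K -> {freeg K / A}) :
    fglift f (\sum_(x <- s) F x) = \sum_(x <- s) fglift f (F x).
  elim: s => [|x s IH]; last by rewrite !big_cons lD IH.
  by rewrite !big_nil l0.
move=> c u v; rewrite lD; congr (_ + _).
rewrite -[in RHS](freeg_sumE u) -[c *: u]/(fgscale c u) /fgscale !lsum.
by rewrite scaler_sumr; apply: eq_bigr => x _; rewrite !liftU scalerA.
Qed.

Section SquareSummable.
Variables (R : realType) (G : groupType).

Definition sqnorm (f : G -> R[i]) : \bar R :=
  \esum_(g in [set: G]) (normc (f g) ^+ 2)%:E.

Definition square_summable : {pred (G -> R[i])} :=
  fun f => (sqnorm f < +oo)%E.

Lemma sqnorm_ge0 f : (0 <= sqnorm f)%E.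
Proof. by apply: esum_ge0 => g _; rewrite lee_fin sqr_ge0. Qed.

Lemma le_esumZl (c : R) (f : G -> \bar R) : 0 <= c -> (forall g, 0 <= f g)%E ->
  (\esum_(g in [set: G]) (c%:E * f g) <= c%:E * \esum_(g in [set: G]) f g)%E.
Proof.
move=> c0 f0; apply: ge_ereal_sup => _ [A [finA _] <-].
rewrite -ge0_mule_fsumr// lee_wpmul2l ?lee_fin//.
by apply: ereal_sup_ubound; exists A.
Qed.

Lemma sqnormZ_le c u : (sqnorm (c *: u)%R <= (normc c ^+ 2)%:E * sqnorm u)%E.
Proof.
apply: le_trans (le_esumZl _ _); rewrite ?sqr_ge0//; last first.
  by move=> g; rewrite lee_fin sqr_ge0.
by apply: le_esum => g _; rewrite -EFinM lee_fin -exprMn -normcM.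
Qed.

Lemma sqnormD_le u v : (sqnorm (u + v)%R <= 2%:E * (sqnorm u + sqnorm v))%E.
Proof.
have n0 z : 0 <= normc z :> R by case: z => a b; exact: sqrtr_ge0.
rewrite /sqnorm -esumD => [|g _|g _]; rewrite ?lee_fin ?sqr_ge0//.
apply: le_trans (le_esumZl _ _) => //; last first.
  by move=> g; rewrite -EFinD lee_fin addr_ge0 ?sqr_ge0.
apply: le_esum => g _; rewrite -EFinD -EFinM lee_fin.
apply: (@le_trans _ _ ((normc (u g) + normc (v g)) ^+ 2)).
  by rewrite ler_sqr ?nnegrE ?addr_ge0 ?n0//; exact: le_normcD.
rewrite -subr_ge0.
have -> : 2 * (normc (u g) ^+ 2 + normc (v g) ^+ 2) -
  (normc (u g) + normc (v g)) ^+ 2 = (normc (u g) - normc (v g)) ^+ 2 by ring.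
exact: sqr_ge0.
Qed.

Lemma square_summable_submod : submod_closed square_summable.
Proof.
split=> [|c u v]; rewrite !unfold_in.
  by rewrite /sqnorm esum1 ?ltry// => g _; rewrite normc0 expr0n.
move=> uoo voo; apply: le_lt_trans (sqnormD_le _ _) _.
have fu : sqnorm u \is a fin_num by rewrite ge0_fin_numE ?sqnorm_ge0.
rewrite lte_mul_pinfty ?lte_fin ?lte_add_pinfty//.
apply: le_lt_trans (sqnormZ_le _ _) _.
by rewrite -(fineK fu) -EFinM ltry.
Qed.

HB.instance Definition _ :=
  GRing.isSubmodClosed.Build R[i] (G -> R[i]) square_summable
    square_summable_submod.

Record ell2 := Ell2 {
  ell2_fun :> G -> R[i];
  ell2P : ell2_fun \in square_summable
}.

HB.instance Definition _ := [isSub for ell2_fun].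
HB.instance Definition _ := [Choice of ell2 by <:].
HB.instance Definition _ := [SubChoice_isSubLmodule of ell2 by <:].

Lemma sqnorm_fin (v : ell2) : sqnorm v \is a fin_num.
Proof. rewrite ge0_fin_numE ?sqnorm_ge0//; exact: ell2P. Qed.

Lemma sqnorm_reindex (s : G -> G) f : bijective s ->
  sqnorm (fun x => f (s x)) = sqnorm f.
Proof.
move=> bij_s; rewrite /sqnorm [RHS](@reindex_esum _ _ _ [set: G] _ s)//.
by split=> // [x y _ _|x _]; [exact: bij_inj|case: bij_s => t ? ?; exists (t x)].
Qed.

Lemma ltrans_subproof (g : G) (v : ell2) :
  (fun x => v (g^-1 * x)%g) \in square_summable.
Proof.
rewrite unfold_in sqnorm_reindex; first exact: ell2P.
by exists (fun x => g * x)%g => x; rewrite ?mulVKg ?mulKg.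
Qed.

Lemma rtrans_subproof (g : G) (v : ell2) :
  (fun x => v (x * g)%g) \in square_summable.
Proof.
rewrite unfold_in sqnorm_reindex; first exact: ell2P.
by exists (fun x => x * g^-1)%g => x; rewrite ?mulgK ?mulgVK.
Qed.

Lemma delta1_subproof : (fun x : G => (x == 1%g)%:R : R[i]) \in square_summable.
Proof.
rewrite unfold_in /sqnorm (esumID [set 1%g]); last first.
  by move=> g _; rewrite lee_fin sqr_ge0.
rewrite setTI esum_set1 ?lee_fin ?sqr_ge0// esum1 ?adde0 ?ltry//.
by move=> g [_ /eqP/negPf ->]; rewrite normc0 expr0n.
Qed.

(* [ltrans g] maps the basis vector x to g x, [rtrans g] maps it to x g^-1. *)
Definition ltrans g v := Ell2 (ltrans_subproof g v).
Definition rtrans g v := Ell2 (rtrans_subproof g v).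
Definition delta1 : ell2 := Ell2 delta1_subproof.


(* N(G) = B(l^2(G))^G: the bounded operators commuting with the left
   translations; G embeds in it by [rtrans]. *)
Definition group_operator : {pred (ell2 -> ell2)} := fun T => `[<
  [/\ linear T,
      exists2 M : R, 0 <= M & forall v, (sqnorm (T v) <= M%:E * sqnorm v)%E
    & forall g v, T (ltrans g v) = ltrans g (T v)] >].

Lemma ltransD g u v : ltrans g (u + v) = ltrans g u + ltrans g v.
Proof. exact: val_inj. Qed.

Lemma ltransZ g c v : ltrans g (c *: v) = c *: ltrans g v.
Proof. exact: val_inj. Qed.

Lemma group_operator_submod : submod_closed group_operator.
Proof.
split=> [|c S T]; rewrite !unfold_in.
  apply/asboolP; split=> [a u v||g v].
    by rewrite -[LHS]/0 -[X in _ = _ + X]/0 -[X in _ *: X]/0 scaler0 addr0.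
    exists 0 => // v; rewrite mul0e.
    by rewrite /sqnorm esum1// => g _; rewrite normc0 expr0n.
  exact: val_inj.
move=> /asboolP[linS [M M0 SM] eqS] /asboolP[linT [N N0 TN] eqT].
apply/asboolP; split=> [a u v||g v].
- rewrite -[LHS]/(c *: S (a *: u + v) + T (a *: u + v)).
  rewrite -[RHS]/(a *: (c *: S u + T u) + (c *: S v + T v)).
  by rewrite linS linT !scalerDr !scalerA mulrC addrACA.
- have cM0 : 0 <= normc c ^+ 2 * M by apply: mulr_ge0 => //; exact: sqr_ge0.
  exists (2 * (normc c ^+ 2 * M + N)); first by rewrite mulr_ge0// addr_ge0.
  move=> v; apply: le_trans (sqnormD_le _ _) _.
  rewrite EFinM -muleA; apply: lee_wpmul2l; first by rewrite lee_fin.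
  rewrite EFinD ge0_muleDl ?lee_fin//.
  apply: leeD; last exact: TN.
  apply: le_trans (sqnormZ_le _ _) _.
  rewrite [in leRHS]EFinM -muleA; apply: lee_wpmul2l => //.
  by rewrite lee_fin sqr_ge0.
- rewrite -[LHS]/(c *: S (ltrans g v) + T (ltrans g v)).
  by rewrite eqS eqT -ltransZ -ltransD.
Qed.

HB.instance Definition _ :=
  GRing.isSubmodClosed.Build R[i] (ell2 -> ell2) group_operator
    group_operator_submod.

Record vN := VN {
  vN_fun :> ell2 -> ell2;
  vNP : vN_fun \in group_operator
}.

HB.instance Definition _ := [isSub for vN_fun].
HB.instance Definition _ := [Choice of vN by <:].
HB.instance Definition _ := [SubChoice_isSubLmodule of vN by <:].

Lemma vN_linear (a : vN) : linear a.
Proof. by have := vNP a; rewrite unfold_in => /asboolP[]. Qed.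

Lemma vN_eq (a b : vN) : (forall v, a v = b v) -> a = b.
Proof. by move=> ab; apply: val_inj; apply/funext. Qed.

Lemma vN_mul_subproof (a b : vN) : a \o b \in group_operator.
Proof.
have := vNP a; have := vNP b; rewrite !unfold_in.
move=> /asboolP[linb [M M0 bM] eqb] /asboolP[lina [N N0 aN] eqa].
apply/asboolP; split=> [c u v||g v] /=; first by rewrite linb lina.
  exists (N * M) => [|v]; first exact: mulr_ge0.
  by apply: le_trans (aN _) _; rewrite EFinM -muleA lee_wpmul2l.
by rewrite eqb eqa.
Qed.

Lemma rtrans_group_operator g : rtrans g \in group_operator.
Proof.
rewrite unfold_in; apply/asboolP; split=> [c u v||h v]; first exact: val_inj.
  exists 1 => // v; rewrite mul1e /= sqnorm_reindex//.
  by exists (fun x => x * g^-1)%g => x; rewrite ?mulgK ?mulgVK.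
by apply: val_inj; apply/funext => x /=; rewrite mulgA.
Qed.

Lemma vN_one_subproof : id \in group_operator.
Proof.
rewrite unfold_in; apply/asboolP; split=> //.
by exists 1 => // v; rewrite mul1e.
Qed.

Definition vN_mul a b := VN (vN_mul_subproof a b).
Definition vN_one := VN vN_one_subproof.

Definition vN_of g := VN (rtrans_group_operator g).

Lemma vN_mulA : associative vN_mul. Proof. by move=> a b c; apply: vN_eq. Qed.
Lemma vN_mul1 : left_id vN_one vN_mul. Proof. by move=> a; apply: vN_eq. Qed.
Lemma vN_1mul : right_id vN_one vN_mul. Proof. by move=> a; apply: vN_eq. Qed.
Lemma vN_mulDl : left_distributive vN_mul +%R.
Proof. by move=> a b c; apply: vN_eq. Qed.
Lemma vN_mulDr : right_distributive vN_mul +%R.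
Proof.
move=> a b c; apply: vN_eq => v /=.
by have := vN_linear a 1 (b v) (c v); rewrite !scale1r.
Qed.
Lemma vN_one_neq0 : vN_one != 0.
Proof.
apply/eqP => /(congr1 (fun a : vN => a delta1 1%g)) /=.
by rewrite eqxx => /eqP; rewrite oner_eq0.
Qed.

HB.instance Definition _ := GRing.Zmodule_isNzRing.Build vN
  vN_mulA vN_mul1 vN_1mul vN_mulDl vN_mulDr vN_one_neq0.

(* Right modules over [vN] are left modules over the converse ring [vN^c]. *)

Definition vN_trace (a : vN) : R[i] := a delta1 1%g.

Definition right_linear n (M : lmodType vN^c) (phi : 'cV[vN]_n -> M) :=
  (forall u v, phi (u + v) = phi u + phi v) /\
  (forall v (a : vN), phi (v *m a%:M) = (a : vN^c) *: phi v).

Definition image_mx n (A : 'M[vN]_n) : set 'cV[vN]_n := range (mulmx A).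

(* [M] is isomorphic to the image of an idempotent matrix of trace [d] (the
   trace of an idempotent is real). *)
Definition fgproj_dim (M : lmodType vN^c) (d : R) : Prop :=
  exists n (A : 'M[vN]_n) (phi : 'cV[vN]_n -> M),
    [/\ A *m A = A, d = complex.Re (\sum_i vN_trace (A i i)),
        right_linear phi & set_bij (image_mx A) [set: M] phi].

(* [M] contains a finitely generated projective submodule of dimension [d]. *)
Definition fgproj_sub_dim (M : lmodType vN^c) (d : R) : Prop :=
  exists n (A : 'M[vN]_n) (phi : 'cV[vN]_n -> M),
    [/\ A *m A = A, d = complex.Re (\sum_i vN_trace (A i i)),
        right_linear phi & set_inj (image_mx A) phi].

(* Lück's dimension function. On a finitely generated projective module it is
   the trace of any idempotent presenting the module; it is extended to an
   arbitrary module by the supremum of the dimensions of the finitely generated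
   projective submodules (the default value of [xget]). *)
Definition vN_dim (M : lmodType vN^c) : \bar R :=
  xget (ereal_sup [set d%:E | d in fgproj_sub_dim M])
       [set d%:E | d in fgproj_dim M].

End SquareSummable.

Arguments delta1 {R G}.

Record rset (G : groupType) := RSet {
  rset_sort :> Type;
  ract : rset_sort -> G -> rset_sort;
  ract1 : forall t, ract t 1%g = t;
  ractM : forall t g h, ract t (g * h)%g = ract (ract t g) h
}.

Definition isotropy G (T : rset G) (t : T) : set G := [set g | ract t g = t].

Definition rorbit G (T : rset G) (t : T) : set T := range (ract t).

Definition rset_proper G (T : rset G) := forall t : T, finite_set (isotropy t).

Definition rset_cofinite G (T : rset G) := finite_set (range (@rorbit G T)).

Record biset (H G : groupType) := Biset {
  biset_rset :> rset G;
  lact : H -> biset_rset -> biset_rset;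
  lact1 : forall t, lact 1%g t = t;
  lactM : forall g h t, lact (g * h)%g t = lact g (lact h t);
  lractA : forall h t g, lact h (ract t g) = ract (lact h t) g
}.

Section BalancedProduct.
Variables (K H G : groupType) (A : biset K H) (B : biset H G).

Definition bprod_rel (p q : {classic A * B}) : bool :=
  `[< exists h : H, p.1 = ract q.1 h /\ q.2 = lact h p.2 >].

Lemma bprod_rel_equiv : equiv_class_of bprod_rel.
Proof.
have sym p q : bprod_rel p q -> bprod_rel q p.
  move=> /asboolP[h [ph qh]]; apply/asboolP; exists h^-1%g.
  by rewrite ph qh -ractM mulgV ract1 -lactM mulVg lact1.
split=> [p|p q|q p r].
- by apply/asboolP; exists 1%g; rewrite ract1 lact1.
- by apply/idP/idP; exact: sym.
- move=> /asboolP[h [ph qh]] /asboolP[k [qk rk]]; apply/asboolP.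
  by exists (k * h)%g; rewrite ph qk ractM rk qh lactM.
Qed.

Canonical bprod_equiv := EquivRelPack bprod_rel_equiv.

(* The quotient of A * B by (a h, b) ~ (a, h b). *)
Definition bprod_sort := {eq_quot bprod_equiv}.
HB.instance Definition _ : EqQuotient _ bprod_rel bprod_sort :=
  EqQuotient.on bprod_sort.
HB.instance Definition _ := Choice.on bprod_sort.

Definition bprod_pi (a : A) (b : B) : bprod_sort :=
  \pi_bprod_sort ((a, b) : {classic A * B}).

Lemma bprod_piP a b a' b' :
  bprod_pi a b = bprod_pi a' b' <->
  exists h : H, a = ract a' h /\ b' = lact h b.
Proof.
split=> [/eqmodP pq|?]; last by apply/eqmodP; apply/asboolP.
exact: (asboolW pq).
Qed.

Lemma bprod_reprK (p : bprod_sort) : bprod_pi (repr p).1 (repr p).2 = p.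
Proof. by rewrite /bprod_pi -surjective_pairing reprK. Qed.

Definition bprod_ract (p : bprod_sort) (g : G) : bprod_sort :=
  bprod_pi (repr p).1 (ract (repr p).2 g).

Definition bprod_lact (k : K) (p : bprod_sort) : bprod_sort :=
  bprod_pi (lact k (repr p).1) (repr p).2.

Lemma bprod_ractE a b g : bprod_ract (bprod_pi a b) g = bprod_pi a (ract b g).
Proof.
have /bprod_piP[h [ah bh]] := bprod_reprK (bprod_pi a b).
by apply/bprod_piP; exists h; split=> //; rewrite {1}bh lractA.
Qed.

Lemma bprod_lactE k a b : bprod_lact k (bprod_pi a b) = bprod_pi (lact k a) b.
Proof.
have /bprod_piP[h [ah bh]] := bprod_reprK (bprod_pi a b).
by apply/bprod_piP; exists h; split=> //; rewrite {1}ah lractA.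
Qed.

Lemma bprod_ract1 p : bprod_ract p 1%g = p.
Proof. by rewrite -[p]bprod_reprK bprod_ractE ract1. Qed.

Lemma bprod_ractM p g h :
  bprod_ract p (g * h)%g = bprod_ract (bprod_ract p g) h.
Proof. by rewrite -[p]bprod_reprK !bprod_ractE ractM. Qed.

Lemma bprod_lact1 p : bprod_lact 1%g p = p.
Proof. by rewrite -[p]bprod_reprK bprod_lactE lact1. Qed.

Lemma bprod_lactM g h p :
  bprod_lact (g * h)%g p = bprod_lact g (bprod_lact h p).
Proof. by rewrite -[p]bprod_reprK !bprod_lactE lactM. Qed.

Definition bprod_rset := RSet bprod_ract1 bprod_ractM.

Lemma bprod_lractA k p g :
  bprod_lact k (bprod_ract p g) = bprod_ract (bprod_lact k p) g.
Proof. by rewrite -[p]bprod_reprK !(bprod_ractE, bprod_lactE). Qed.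

Definition bprod : biset K G :=
  @Biset K G bprod_rset _ bprod_lact1 bprod_lactM bprod_lractA.

End BalancedProduct.

Section SetDimension.
Variables (R : realType) (G : groupType) (T : rset G).

Local Notation QG := {freeg G / rat}.
Local Notation QT := {freeg {classic T} / rat}.
Local Notation N := (vN R G).

Definition qract (m : QT) (r : QG) : QT :=
  fglift (fun t : {classic T} =>
    fglift (fun g => << (ract t g : {classic T}) >>) r) m.

Definition vN_of_QG (r : QG) : N :=
  \sum_(g <- dom r) (ratr (coeff g r) : R[i]) *: vN_of R g.

(* The subgroup of relations of QT (x)_QG N(G) in the free abelian group on
   QT * N(G). *)
Inductive tensor_rel : {freeg (QT * N)%type / int} -> Prop :=
| TensorRelDl m m' a :
    tensor_rel (<< (m + m', a) >> - << (m, a) >> - << (m', a) >>)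
| TensorRelDr m a a' :
    tensor_rel (<< (m, a + a') >> - << (m, a) >> - << (m, a') >>)
| TensorRelM m r a :
    tensor_rel (<< (qract m r, a) >> - << (m, vN_of_QG r * a) >>)
| TensorRel0 : tensor_rel 0
| TensorRelB z z' : tensor_rel z -> tensor_rel z' -> tensor_rel (z - z').

Definition tensor_relb : {pred {freeg (QT * N)%type / int}} :=
  fun z => `[< tensor_rel z >].

Lemma tensor_rel_zmod : zmod_closed tensor_relb.
Proof.
split=> [|z z']; rewrite !unfold_in; first exact/asboolP/TensorRel0.
by move=> /asboolP hz /asboolP hz'; exact/asboolP/TensorRelB.
Qed.

HB.instance Definition _ :=
  GRing.isZmodClosed.Build {freeg (QT * N)%type / int} tensor_relb
    tensor_rel_zmod.

(* QT (x)_QG N(G) *)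
Definition tensor := Quotient.quot tensor_relb.
HB.instance Definition _ := GRing.Zmodule.on tensor.

Definition tensor_pi (z : {freeg (QT * N)%type / int}) : tensor :=
  \pi_tensor z.

Lemma tensor_piP z z' : tensor_pi z = tensor_pi z' <-> tensor_rel (z - z').
Proof.
by split=> [/eqmodP|?]; rewrite ?unfold_in; [move/asboolP|apply/eqmodP/asboolP].
Qed.

Definition free_mulr (a : N) (z : {freeg (QT * N)%type / int}) :
    {freeg (QT * N)%type / int} :=
  fglift (fun p : QT * N => << (p.1, p.2 * a) >>) z.

Definition tensor_mulr (a : N^c) (x : tensor) : tensor :=
  tensor_pi (free_mulr a (repr x)).

Lemma free_mulrB a z z' : free_mulr a (z - z') = free_mulr a z - free_mulr a z'.
Proof. exact: lift_is_additive. Qed.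

Lemma free_mulr0 a : free_mulr a 0 = 0.
Proof. by have := free_mulrB a 0 0; rewrite !subrr. Qed.

Lemma free_mulrU a p : free_mulr a << p >> = << (p.1, p.2 * a) >>.
Proof. by rewrite /free_mulr liftU scale1r. Qed.

Lemma free_mulr_rel a z : tensor_rel z -> tensor_rel (free_mulr a z).
Proof.
elim=> [m m' b|m b b'|m r b||y y' _ Hy _ Hy']; rewrite ?free_mulrB ?free_mulrU/=.
- exact: TensorRelDl.
- by rewrite mulrDl; exact: TensorRelDr.
- by rewrite -mulrA; exact: TensorRelM.
- by rewrite free_mulr0; exact: TensorRel0.
- exact: TensorRelB.
Qed.

Lemma tensor_mulrE (a : N) z :
  tensor_mulr a (tensor_pi z) = tensor_pi (free_mulr a z).
Proof.
apply/tensor_piP; rewrite -free_mulrB; apply: free_mulr_rel.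
by apply/tensor_piP; rewrite /tensor_pi reprK.
Qed.

Lemma tensor_piB z z' : tensor_pi (z - z') = tensor_pi z - tensor_pi z'.
Proof. by rewrite /tensor_pi !piE. Qed.

Lemma tensor_piD z z' : tensor_pi (z + z') = tensor_pi z + tensor_pi z'.
Proof. by rewrite /tensor_pi !piE. Qed.

Lemma tensor_ind (P : tensor -> Prop) :
  (forall z, P (tensor_pi z)) -> forall x, P x.
Proof. by move=> Pz x; rewrite -[x]reprK; exact: Pz. Qed.

Lemma free_ind (P : {freeg (QT * N)%type / int} -> Prop) :
  P 0 -> (forall p, P << p >>) -> (forall z z', P z -> P z' -> P (z - z')) ->
  forall z, P z.
Proof.
move=> P0 PU PB z; have PN y : P y -> P (- y) by rewrite -sub0r; exact: PB.
have PD y y' : P y -> P y' -> P (y + y').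
  by move=> Py /PN; rewrite -{2}[y']opprK; exact: PB.
rewrite -(freeg_sumE z); elim/big_ind: _ => // p _.
move: (coeff p z) => c; rewrite -[c]intz -freegU_mulz.
have Pn n : P (<< p >> *+ n).
  elim: n => [|n IH]; first by rewrite mulr0n.
  by rewrite mulrS; apply: PD; [exact: PU|exact: IH].
by case: c => n; [rewrite -pmulrn|rewrite NegzE -nmulrn; exact: PN].
Qed.

Lemma tensor_mulrA (a b : N^c) x :
  tensor_mulr a (tensor_mulr b x) = tensor_mulr (a * b) x.
Proof.
elim/tensor_ind: x => z; rewrite !tensor_mulrE; congr tensor_pi.
elim/free_ind: z => [|p|z z' Hz Hz']; rewrite ?free_mulrB ?Hz ?Hz' //.
  by rewrite !free_mulr0.
by rewrite !free_mulrU /= -mulrA.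
Qed.

Lemma tensor_mulr1 x : tensor_mulr 1 x = x.
Proof.
elim/tensor_ind: x => z; rewrite tensor_mulrE; congr tensor_pi.
elim/free_ind: z => [|p|z z' Hz Hz']; rewrite ?free_mulrB ?Hz ?Hz' //.
  by rewrite !free_mulr0.
by rewrite !free_mulrU mulr1 -surjective_pairing.
Qed.

Lemma tensor_mulrDr (a : N^c) : {morph tensor_mulr a : x y / x + y}.
Proof.
move=> x y; elim/tensor_ind: x => z; elim/tensor_ind: y => z'.
rewrite -tensor_piD !tensor_mulrE -tensor_piD; congr tensor_pi.
have fN y : free_mulr a (- y) = - free_mulr a y.
  by rewrite -[in LHS](sub0r y) free_mulrB free_mulr0 sub0r.
by rewrite -[in LHS](opprK z') free_mulrB fN opprK.
Qed.

Lemma tensor_mulrDl x : {morph tensor_mulr^~ x : a b / a + b}.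
Proof.
move=> a b; elim/tensor_ind: x => z /=; rewrite !tensor_mulrE.
elim/free_ind: z => [|p|z z' Hz Hz'].
- by rewrite -tensor_piD !free_mulr0 addr0.
- rewrite !free_mulrU mulrDr -tensor_piD; apply/tensor_piP.
  by rewrite opprD addrA; exact: TensorRelDr.
- by rewrite !free_mulrB !tensor_piB Hz Hz' opprD addrACA.
Qed.

HB.instance Definition _ := GRing.Zmodule_isLmodule.Build N^c tensor
  tensor_mulrA tensor_mulr1 tensor_mulrDr tensor_mulrDl.

(* dim_N(G) (QT (x)_QG N(G)) *)
Definition rset_dim : \bar R := vN_dim tensor.

(* The dimension as a rational number, to be used when it is one (as for proper
   cofinite T); 0 otherwise. *)
Definition rset_rdim : rat := xget 0 [set q : rat | rset_dim = (ratr q)%:E].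

End SetDimension.

Record category := Category {
  ob :> Type;
  mor : ob -> ob -> Type;
  idm : forall x, mor x x;
  mcomp : forall x y z, mor y z -> mor x y -> mor x z;
  comp1m : forall x y (f : mor x y), mcomp (idm y) f = f;
  compm1 : forall x y (f : mor x y), mcomp f (idm x) = f;
  compA : forall w x y z (f : mor y z) (g : mor x y) (h : mor w x),
    mcomp f (mcomp g h) = mcomp (mcomp f g) h
}.

Arguments idm {c} x.

Section Automorphisms.
Variable C : category.

Definition is_inverse (x y : C) (f : mor x y) (g : mor y x) :=
  mcomp g f = idm x /\ mcomp f g = idm y.

Definition is_iso (x y : C) (f : mor x y) := exists g, is_inverse f g.

Record aut (x : C) := Aut { aut_mor :> mor x x; aut_iso : is_iso aut_mor }.

HB.instance Definition _ x := gen_eqMixin (aut x).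
HB.instance Definition _ x := gen_choiceMixin (aut x).

Lemma aut_inj x (f g : aut x) : aut_mor f = aut_mor g -> f = g.
Proof.
by case: f g => [f Hf] [g Hg] /= fg; subst g; congr Aut; exact: Prop_irrelevance.
Qed.

Lemma aut_one_subproof (x : C) : is_iso (idm x).
Proof. by exists (idm x); split; rewrite comp1m. Qed.

Lemma aut_mul_subproof x (f g : aut x) : is_iso (mcomp f g).
Proof.
case: f g => [f [f' [f'f ff']]] [g [g' [g'g gg']]] /=; exists (mcomp g' f').
split; first by rewrite -compA (compA f') f'f comp1m.
by rewrite -compA (compA g) gg' comp1m.
Qed.

Lemma aut_inv_subproof x (f : aut x) : is_iso (projT1 (cid (aut_iso f))).
Proof. by case: cid => g [gf fg] /=; exists f; split. Qed.

Definition aut_one x := Aut (aut_one_subproof x).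
Definition aut_mul x (f g : aut x) := Aut (aut_mul_subproof f g).
Definition aut_inv x (f : aut x) := Aut (aut_inv_subproof f).

Lemma aut_mulA x : associative (@aut_mul x).
Proof. by move=> f g h; apply: aut_inj; rewrite /= compA. Qed.
Lemma aut_mul1 x : left_id (aut_one x) (@aut_mul x).
Proof. by move=> f; apply: aut_inj; rewrite /= comp1m. Qed.
Lemma aut_1mul x : right_id (aut_one x) (@aut_mul x).
Proof. by move=> f; apply: aut_inj; rewrite /= compm1. Qed.
Lemma aut_mulV x : left_inverse (aut_one x) (@aut_inv x) (@aut_mul x).
Proof. by move=> f; apply: aut_inj; rewrite /=; case: cid => g []. Qed.
Lemma aut_Vmul x : right_inverse (aut_one x) (@aut_inv x) (@aut_mul x).
Proof. by move=> f; apply: aut_inj; rewrite /=; case: cid => g []. Qed.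

HB.instance Definition _ x := isGroup.Build (aut x)
  (@aut_mulA x) (@aut_mul1 x) (@aut_1mul x) (@aut_mulV x) (@aut_Vmul x).

Section MorphismSets.
Variables x y : C.

Definition mor_ract (f : mor x y) (g : aut x) : mor x y := mcomp f g.
Definition mor_lact (g : aut y) (f : mor x y) : mor x y := mcomp g f.

Lemma mor_ract1 f : mor_ract f 1%g = f. Proof. exact: compm1. Qed.
Lemma mor_ractM f g h : mor_ract f (g * h)%g = mor_ract (mor_ract f g) h.
Proof. exact: compA. Qed.
Lemma mor_lact1 f : mor_lact 1%g f = f. Proof. exact: comp1m. Qed.
Lemma mor_lactM g h f : mor_lact (g * h)%g f = mor_lact g (mor_lact h f).
Proof. by rewrite /mor_lact compA. Qed.
Lemma mor_lractA h f g : mor_lact h (mor_ract f g) = mor_ract (mor_lact h f) g.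
Proof. exact: compA. Qed.

Definition mor_biset : biset (aut y) (aut x) :=
  @Biset _ _ (RSet mor_ract1 mor_ractM) _ mor_lact1 mor_lactM mor_lractA.

End MorphismSets.

Definition isomorphic (x y : {classic C}) : bool :=
  `[< exists f : mor (x : C) (y : C), is_iso f >].

Lemma isomorphic_equiv : equiv_class_of isomorphic.
Proof.
have sym x y : isomorphic x y -> isomorphic y x.
  by move=> /asboolP[f [g [gf fg]]]; apply/asboolP; exists g, f; split.
split=> [x|x y|y x z].
- by apply/asboolP; exists (idm x); exact: aut_one_subproof.
- by apply/idP/idP; exact: sym.
- move=> /asboolP[f [f' [f'f ff']]] /asboolP[g [g' [g'g gg']]].
  apply/asboolP; exists (mcomp g f), (mcomp f' g').
  split; first by rewrite -compA (compA g') g'g comp1m.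
  by rewrite -compA (compA f) ff' comp1m.
Qed.

Canonical isomorphic_equiv_rel := EquivRelPack isomorphic_equiv.

(* The set iso(C) of isomorphism classes of objects; [repr] is the choice of
   representatives. *)
Definition iso := {eq_quot isomorphic_equiv_rel}.
HB.instance Definition _ : EqQuotient _ isomorphic iso := EqQuotient.on iso.
HB.instance Definition _ := Choice.on iso.

Definition rep (x : iso) : C := repr x.

Definition iso_le (y x : iso) : bool := `[< inhabited (mor (rep y) (rep x)) >].
Definition iso_lt (y x : iso) : bool := (y != x) && iso_le y x.

Definition EI := forall (x : C) (f : mor x x), is_iso f.

Definition quasi_finite :=
  (forall x : iso, finite_set [set y | iso_le y x]) /\
  (forall x y : C, rset_proper (mor_biset x y) /\ rset_cofinite (mor_biset x y)).

Definition is_free :=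
  forall (x y : C) (g : aut y) (f : mor_biset x y), lact g f = f -> g = 1%g.

(* A chain y = x_0 < ... < x_l = x is represented by [:: x_1; ...; x_l]. *)
Definition chain (l : nat) (y x : iso) : set (seq iso) :=
  [set c | [/\ path iso_lt y c, size c = l & last y c = x]].

Fixpoint chain_biset (y : iso) (c : seq iso) :
    biset (aut (rep (last y c))) (aut (rep y)) :=
  match c with
  | [::] => mor_biset (rep y) (rep y)
  | x1 :: c' =>
      match c' return biset (aut (rep (last x1 c'))) (aut (rep x1)) ->
                      biset (aut (rep (last x1 c'))) (aut (rep y)) with
      | [::] => fun=> mor_biset (rep y) (rep x1)
      | _ => fun S => bprod S (mor_biset (rep y) (rep x1))
      end (chain_biset x1 c')
  end.

Section Homomorphisms.
Variable R : realType.

Definition omega_entry (x y : iso) : rat :=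
  rset_rdim R (mor_biset (rep y) (rep x)).

(* For a quasi-finite category both sums are finite: [chain l y x] is finite, and
   empty for large l. *)
Definition mu_entry (x y : iso) : rat :=
  \sum_(l \in [set: nat]) (-1) ^+ l *
    \sum_(c \in chain l y x) rset_rdim R (chain_biset y c).

(* U(C) (x) Q, for U(C) the free abelian group on iso(C). *)
Definition UQ := {freeg iso / rat}.

(* The linear map whose component from the x-summand to the y-summand is
   [W x y]; the sum over y is zero by convention if infinitely many [W x y] are
   nonzero, which does not happen for a quasi-finite category. *)
Definition matrix_hom (W : iso -> iso -> rat) : UQ -> UQ :=
  fglift (fun x => \sum_(y \in [set: iso]) W x y *: (<< y >> : UQ)).

Lemma matrix_hom_linear W : linear (matrix_hom W).
Proof. exact: fglift_linear. Qed.

HB.instance Definition _ W :=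
  GRing.isLinear.Build rat UQ UQ *:%R (matrix_hom W) (matrix_hom_linear W).

Definition omega : {linear UQ -> UQ} := matrix_hom omega_entry.
Definition mu : {linear UQ -> UQ} := matrix_hom mu_entry.

End Homomorphisms.

End Automorphisms.

Arguments omega C R : clear implicits.
Arguments mu C R : clear implicits.

(* Main.v *)
Require Import Defs.
From mathcomp Require Import all_boot all_order all_algebra.
From mathcomp Require Import generic_quotient finmap.
From mathcomp Require Import all_classical all_reals.
From mathcomp Require Import ereal esum complex freeg.
From mathcomp Require Import lra.

(** The argument separates the analytic notion of dimension from a purely
    combinatorial inversion.

    Dimension.  For a finite family of points s_i of a right G-set T and
    rational weights w_i such that, for every t, the weighted number
    sum_i w_i #{g | s_i g = t} equals 1, the dimension of QT (x) N(G) is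
    sum_i w_i.  Indeed the hypothesis ensures that the map N(G)^n -> QT (x)
    N(G) sending the i-th basis vector to s_i (x) 1 has the section t (x) a |->
    (w_i sum_(s_i g = t) g a)_i; so the module is the image of an idempotent
    matrix, whose i-th diagonal entry is w_i times the sum of the isotropy group
    of s_i and has trace w_i ([fgproj_dim_cover]).  That the trace of an
    idempotent depends only on its image follows from tr(ab) = tr(ba); both
    sides are the sum over g of u(g) v(g^-1), for u and v the images of
    [delta1] under a and b ([vN_traceC]).

    Working with such weighted families ([has_mass]) in place of orbit
    decompositions makes the dimension computable by plain double counting.
    Orbit representatives weighted by 1 / |isotropy| show that every proper
    cofinite set has a family; and if H acts freely on the left of T, the
    products of the points of two families form a family for S x_H T, with the
    products of the weights, so dimensions multiply ([has_mass_bprod]).  In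
    particular the dimension of S(c) is the product of the entries of omega
    along the chain c ([has_mass_chain]).

    Inversion.  The order on isomorphism classes makes omega = 1 + nu with nu
    strictly triangular; the sum over chains of length l of the products above
    is the matrix of nu^l ([iter_nu]), so mu is the Neumann series
    sum_l (-nu)^l ([muE]).  The series is finite on each vector since lower sets
    are finite, whence omega mu = 1 by telescoping, and omega is injective since
    nu is locally nilpotent; therefore mu omega = 1 as well. *)

Set Implicit Arguments.
Unset Strict Implicit.
Unset Printing Implicit Defensive.

Import Order.TTheory GRing.Theory Num.Theory Normc.

Local Open Scope classical_set_scope.
Local Open Scope quotient_scope.
Local Open Scope ring_scope.

(** * The trace of the group von Neumann algebra *)

Section Trace.
Variables (R : realType) (G : groupType).
Local Notation ell2 := (ell2 R G).
Local Notation N := (vN R G).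
Implicit Types (u v : ell2) (a b : N).

Lemma ell2_sumE (I : Type) (r : seq I) (F : I -> ell2) x :
  (\sum_(i <- r) F i) x = \sum_(i <- r) F i x.
Proof. by elim/big_ind2: _ => // y1 x1 y2 x2 <- <-. Qed.

Lemma normc_ge0 (z : R[i]) : 0 <= normc z.
Proof. by case: z => a b; exact: sqrtr_ge0. Qed.

Lemma normc_le_sqnorm v x : ((normc (v x) ^+ 2)%:E <= sqnorm v)%E.
Proof.
apply: esum_ge; exists [set x]; first by split=> //; exact: finite_set1.
by rewrite fsbig_set1.
Qed.

Definition basis (g : G) : ell2 := ltrans g delta1.

Definition truncate (A : seq G) v : ell2 := \sum_(g <- A) v g *: basis g.

Lemma basisE g x : basis g x = (x == g)%:R.
Proof. by rewrite /= -(inj_eq (mulgI g)) mulVKg mulg1. Qed.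

Lemma truncateE (A : {fset G}) v x :
  truncate A v x = if x \in A then v x else 0.
Proof.
rewrite ell2_sumE; case: ifPn => xA.
  rewrite (big_fsetD1 x)//= -[LHS]/(v x * basis x x + _) basisE eqxx mulr1.
  rewrite big_seq big1 ?addr0// => g; rewrite !inE => /andP[gx _].
  by rewrite -[LHS]/(v g * basis g x) basisE eq_sym (negPf gx) mulr0.
rewrite big_seq big1// => g gA; rewrite -[LHS]/(v g * basis g x) basisE.
by case: eqP => [xg|]; rewrite ?mulr0//; rewrite xg gA in xA.
Qed.

(** Quantifying over all larger B lets two approximations be carried out over
    one common finite set, as [vN_traceC] needs. *)
Lemma truncate_approx (e : R) v : 0 < e -> exists A : {fset G},
  forall B : {fset G}, (A `<=` B)%fset ->
  (sqnorm (v - truncate B v)%R <= e%:E)%E.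
Proof.
move=> e0; pose f g := (normc (v g) ^+ 2)%:E.
have f0 g : (0 <= f g)%E by rewrite lee_fin sqr_ge0.
have finv : (sqnorm v \is a fin_num)%E := sqnorm_fin v.
have [_ [X [finX _] <-]] := ub_ereal_sup_adherent e0 finv => HX.
exists (fset_set X) => B /fsubsetP AB.
have XB : X `<=` [set` B].
  by move=> g Xg /=; apply: AB; rewrite in_fset_set ?inE.
have f0' (A : set G) g : A g -> (0 <= f g)%E by [].
have le_rest : (sqnorm (v - truncate B v)%R <= \esum_(g in ~` X) f g)%E.
  rewrite [leRHS]esum_mkcond; apply: le_esum => g _.
  rewrite -[X in normc X]/(v g - truncate B v g) truncateE.
  case: (boolP (g \in B)) => gB; rewrite ?subrr ?subr0.
    by rewrite normc0 expr0n; case: ifP.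
  by rewrite mem_set//= => /XB gB'; rewrite gB' in gB.
apply: le_trans le_rest _.
have := @esumID R G X setT f (f0' setT); rewrite -/(sqnorm v) !setTI.
rewrite [X in (X + _)%E]esum_fset// => vE.
have vE' : sqnorm v = (\sum_(g \in X) f g + \esum_(g in ~` X) f g)%E by [].
rewrite -[ereal_sup _]/(sqnorm v) in HX.
have S0 : (0 <= \esum_(g in ~` X) f g)%E by apply: esum_ge0.
have F0 : (0 <= \sum_(g \in X) f g)%E by exact: fsume_ge0.
move: vE' finv HX S0 F0; move: (sqnorm v) (\esum_(g in ~` X) f g) => s t.
rewrite -/f; move: (\sum_(g \in X) f g)%E => r.
case: s => [s| |]//; case: t => [t| |]//; case: r => [r| |]//= [->] _.
rewrite !lee_fin -EFinB lte_fin => *; lra.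
Qed.

Lemma vNZ a (c : R[i]) v : a (c *: v) = c *: a v.
Proof.
have a0 : a 0 = 0.
  by have := vN_linear a (-1) 0 0; rewrite scaler0 addr0 scaleN1r addNr.
by have := vN_linear a c v 0; rewrite a0 !addr0.
Qed.

(** By equivariance, an operator is determined on finite combinations of basis
    vectors by its value at [delta1]. *)
Lemma vN_truncate a v (A : {fset G}) :
  a (truncate A v) 1%g = \sum_(g <- A) v g * a delta1 g^-1%g.
Proof.
have -> : a (truncate A v) = \sum_(g <- A) v g *: ltrans g (a delta1).
  rewrite /truncate; elim: (A : seq G) => [|g s IH].
    by have := vNZ a 0 0; rewrite !big_nil !scale0r.
  rewrite !big_cons vN_linear IH.
  have [_ _ ->//] := asboolW (vNP a).
rewrite ell2_sumE; apply: eq_bigr => g _.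
by rewrite -[LHS]/(v g * a delta1 (g^-1 * 1)%g) mulg1.
Qed.

Lemma vN_bound a : exists2 M : R, 0 < M &
  forall v, (sqnorm (a v) <= M%:E * sqnorm v)%E.
Proof.
have [_ [M M0 aM] _] := asboolW (vNP a); exists (M + 1); first by lra.
move=> v; apply: le_trans (aM v) _; rewrite lee_wpmul2r ?sqnorm_ge0// lee_fin.
lra.
Qed.

Lemma vN_approx (e : R) a v : 0 < e -> exists A : {fset G},
  forall B : {fset G}, (A `<=` B)%fset ->
  normc (a v 1%g - \sum_(g <- B) v g * a delta1 g^-1%g) <= e.
Proof.
move=> e0; have [M M0 aM] := vN_bound a.
have [A HA] := truncate_approx v (divr_gt0 (exprn_gt0 2 e0) M0).
exists A => B /HA HB; rewrite -vN_truncate.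
have := le_trans (normc_le_sqnorm _ 1%g) (le_trans (aM _) (lee_wpmul2l _ HB)).
rewrite lee_fin => /(_ (ltW M0)); rewrite -EFinM mulrC divfK ?gt_eqF// lee_fin.
have -> : a (v - truncate B v) = a v - a (truncate B v).
  by rewrite addrC -scaleN1r vN_linear scaleN1r addrC.
rewrite ler_sqr ?nnegrE ?normc_ge0//; exact: ltW.
Qed.

(** Over a finite set that is symmetric under inversion, the finite sums
    approximating tr(ab) and tr(ba) coincide. *)
Lemma vN_traceC a b : vN_trace (a * b) = vN_trace (b * a).
Proof.
rewrite /vN_trace -[(a * b) _]/(a (b delta1)) -[(b * a) _]/(b (a delta1)).
apply/eqP; rewrite -subr_eq0; apply/eqP/eq0_normc/le_anti.
rewrite normc_ge0 andbT.
apply/ler_addgt0Pr => e e0; rewrite add0r.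
have [A HA] := vN_approx a (b delta1) (divr_gt0 e0 (ltr0n _ 2)).
have [B HB] := vN_approx b (a delta1) (divr_gt0 e0 (ltr0n _ 2)).
pose D := ((A `|` B) `|` [fset g^-1%g | g in A `|` B])%fset.
have AD : (A `<=` D)%fset by rewrite /D -fsetUA fsubsetUl.
have BD : (B `<=` D)%fset by rewrite /D fsetUAC fsubsetUr.
have symD g : g \in D -> g^-1%g \in D.
  rewrite !inE => /orP[gAB|/imfsetP[h hAB ->]].
    by apply/orP; right; apply/imfsetP; exists g; rewrite //= inE.
  by rewrite invgK; move: hAB; rewrite !inE => ->.
have sumE : \sum_(g <- D) b delta1 g * a delta1 g^-1%g =
            \sum_(g <- D) a delta1 g * b delta1 g^-1%g.
  rewrite [LHS](perm_big [seq g^-1%g | g <- D]) /=; last first.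
    apply: uniq_perm; rewrite ?fset_uniq ?map_inj_uniq ?fset_uniq//.
      exact: invg_inj.
    move=> g; apply/idP/mapP => [gD|[h hD ->]]; last exact: symD.
    by exists g^-1%g; rewrite ?invgK// symD.
  by rewrite big_map; apply: eq_bigr => g _; rewrite invgK mulrC.
have {}HA := HA _ AD; have {}HB := HB _ BD; rewrite sumE in HA.
set S := \sum_(g <- D) _ in HA HB.
rewrite -(subrKA S) [e]splitr; apply: le_trans (le_normcD _ _) _.
by rewrite lerD// -normcN opprB.
Qed.

End Trace.

(** * Uniqueness of the dimension of a projective module *)

Section DimensionUniqueness.
Variables (R : realType) (G : groupType).
Local Notation N := (vN R G).

Lemma vN_trace_sum (I : Type) (r : seq I) (F : I -> N) :
  vN_trace (\sum_(i <- r) F i) = \sum_(i <- r) vN_trace (F i).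
Proof. by elim/big_ind2: _ => // a x b y <- <-. Qed.

Definition mx_trace n (A : 'M[N]_n) : R[i] := \sum_i vN_trace (A i i).

Lemma mx_traceC m n (X : 'M[N]_(m, n)) (Y : 'M[N]_(n, m)) :
  mx_trace (X *m Y) = mx_trace (Y *m X).
Proof.
rewrite /mx_trace; under eq_bigr do rewrite mxE vN_trace_sum.
under [RHS]eq_bigr do rewrite mxE vN_trace_sum.
rewrite exchange_big; apply: eq_bigr => j _; apply: eq_bigr => i _.
exact: vN_traceC.
Qed.

Lemma mulmx_sum_scale m n (X : 'M[N]_(m, n)) (v : 'cV[N]_n) :
  X *m v = \sum_j col j X *m (v j 0)%:M.
Proof.
apply/matrixP => i k; rewrite ord1 mxE summxE; apply: eq_bigr => j _.
by rewrite mxE big_ord1 !mxE eqxx mulr1n.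
Qed.

Lemma right_linear_mulmx (M : lmodType N^c) m n (phi : 'cV[N]_m -> M)
    (X : 'M[N]_(m, n)) v : right_linear phi ->
  phi (X *m v) = \sum_j (v j 0 : N^c) *: phi (col j X).
Proof.
move=> [phiD phiZ]; have phi0 : phi 0 = 0.
  by apply: (addrI (phi 0)); rewrite -phiD !addr0.
rewrite mulmx_sum_scale (big_morph phi phiD phi0).
by apply: eq_bigr => j _; rewrite phiZ.
Qed.

Lemma mulmx_ext m n (A B : 'M[N]_(m, n)) :
  (forall v : 'cV_n, A *m v = B *m v) -> A = B.
Proof.
by move=> AB; apply/matrixP => i j; have /colP/(_ i) := AB (delta_mx j 0);
  rewrite -!colE !mxE.
Qed.

(** The image of A is projective, so phi factors through psi; the factorization
    is given by a matrix because right-linear maps are determined by the images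
    of the columns. *)
Lemma idempotent_lift (M : lmodType N^c) m n (A : 'M[N]_n) (B : 'M[N]_m)
    (phi : 'cV[N]_n -> M) (psi : 'cV[N]_m -> M) :
  B *m B = B -> right_linear phi -> right_linear psi ->
  set_surj (image_mx B) [set: M] psi ->
  exists2 X : 'M[N]_(m, n), B *m X = X &
    forall v, psi (X *m v) = phi (A *m v).
Proof.
move=> BB phiL psiL psiS.
have /choice[x Hx] : forall j, exists x : 'cV[N]_m,
    B *m x = x /\ psi x = phi (col j A).
  move=> j; have [_ [v _ <-] <-] := psiS (phi (col j A)) I.
  by exists (B *m v); rewrite mulmxA BB.
pose X := \matrix_(i, j) x j i 0.
have colX j : col j X = x j by apply/colP => i; rewrite !mxE.
exists X => [|v].
  apply/mulmx_ext => v; rewrite -mulmxA (mulmx_sum_scale X) mulmx_sumr.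
  by apply: eq_bigr => j _; rewrite mulmxA colX (Hx j).1.
rewrite (right_linear_mulmx X)// (right_linear_mulmx A)//.
by apply: eq_bigr => j _; rewrite colX (Hx j).2.
Qed.

(** The comparison matrices X and Y between two presentations of M satisfy
    X Y = B and Y X = A, so the traces agree. *)
Lemma fgproj_dim_unique (M : lmodType N^c) (d d' : R) :
  fgproj_dim M d -> fgproj_dim M d' -> d = d'.
Proof.
move=> [n [A [phi [AA -> phiL [_ phiI phiS]]]]].
move=> [m [B [psi [BB -> psiL [_ psiI psiS]]]]].
have [X BX Xv] := idempotent_lift A BB phiL psiL psiS.
have [Y AY Yv] := idempotent_lift B AA psiL phiL phiS.
have image k (C D : 'M[N]_k) v : C *m D = D -> D *m v \in image_mx C.
  by move=> CD; apply/mem_set; exists (D *m v); rewrite // mulmxA CD.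
suff [<- <-] : X *m Y = B /\ Y *m X = A by rewrite -!/(mx_trace _) mx_traceC.
split; apply: mulmx_ext => v.
  apply: psiI; rewrite ?image ?mulmxA ?BX//.
  by rewrite -mulmxA Xv mulmxA AY Yv.
apply: phiI; rewrite ?image ?mulmxA ?AY//.
by rewrite -mulmxA Yv mulmxA BX Xv.
Qed.

Lemma vN_dimE (M : lmodType N^c) (d : R) : fgproj_dim M d -> vN_dim M = d%:E.
Proof.
move=> Md; apply: xget_unique; first by exists d.
by move=> _ [d' Md' <-]; rewrite (fgproj_dim_unique Md Md').
Qed.

Lemma rset_rdimE (T : rset G) (q : rat) :
  fgproj_dim (tensor R T : lmodType N^c) (ratr q) -> rset_rdim R T = q.
Proof.
move=> /vN_dimE dimE; apply: xget_unique => [//|q' /=].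
by rewrite /rset_dim dimE => -[/fmorph_inj].
Qed.

End DimensionUniqueness.

(** * Linear maps out of a free module *)

Section FreeModules.

Section Lift.
Variables (A : nzRingType) (K : choiceType) (M : lmodType A) (f : K -> M).

Lemma fgliftD m m' : fglift f (m + m') = fglift f m + fglift f m'.
Proof. by rewrite -{1}[m]scale1r fglift_linear scale1r. Qed.

Lemma fglift0 : fglift f 0 = 0.
Proof. by apply: (addrI (fglift f 0)); rewrite -fgliftD !addr0. Qed.

Lemma fgliftZ c m : fglift f (c *: m) = c *: fglift f m.
Proof. by rewrite -[c *: m]addr0 fglift_linear fglift0 addr0. Qed.

Lemma fgliftU k : fglift f << k >> = f k.
Proof. by rewrite liftU scale1r. Qed.

Lemma fglift_sum (I : Type) (r : seq I) F :
  fglift f (\sum_(i <- r) F i) = \sum_(i <- r) fglift f (F i).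
Proof. exact: (big_morph _ fgliftD fglift0). Qed.

End Lift.

Lemma freegUZ (A : nzRingType) (K : choiceType) (c : A) (k : K) :
  << c *g k >> = c *: (<< k >> : {freeg K / A}).
Proof. by apply/eqP/freeg_eqP => x; rewrite coeffZ !coeffU mul1r. Qed.

Lemma freeg_ind (A : nzRingType) (K : choiceType) (P : {freeg K / A} -> Prop) :
  P 0 -> (forall c k m, P m -> P (c *: << k >> + m)) -> forall m, P m.
Proof.
move=> P0 PD m; rewrite -(freeg_sumE m).
elim: (dom m) => [|k s IH]; rewrite ?big_nil// big_cons freegUZ; exact: PD.
Qed.

Variables (F : numFieldType) (K : choiceType) (V : lmodType F) (h : K -> V).

(** The extension of h to a map that is linear over rat, V being regarded as a
    rational vector space through [ratr]. *)
Definition rat_lift (m : {freeg K / rat}) : V :=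
  \sum_(k <- dom m) (ratr (coeff k m) : F) *: h k.

Lemma rat_liftE (s : seq K) m : uniq s -> {subset dom m <= s} ->
  rat_lift m = \sum_(k <- s) (ratr (coeff k m) : F) *: h k.
Proof.
move=> us ms; rewrite [RHS](bigID (mem (dom m)))/= [X in _ + X]big1 => [|k km].
  rewrite addr0 -[RHS]big_filter; apply: perm_big; apply: uniq_perm.
  - exact: uniq_dom.
  - exact: filter_uniq.
  - by move=> k; rewrite mem_filter; case: (boolP (k \in dom m)) => [/ms->|].
by rewrite (coeff_outdom km) rmorph0 scale0r.
Qed.

Lemma rat_liftD m m' : rat_lift (m + m') = rat_lift m + rat_lift m'.
Proof.
pose s := undup (dom m ++ dom m').
rewrite !(@rat_liftE s) ?undup_uniq//.
- by rewrite -big_split; apply: eq_bigr => k _; rewrite coeffD rmorphD scalerDl.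
- by move=> k km; rewrite mem_undup mem_cat km orbT.
- by move=> k km; rewrite mem_undup mem_cat km.
- by move=> k /domD_subset; rewrite mem_undup.
Qed.

Lemma rat_lift0 : rat_lift 0 = 0.
Proof. by rewrite /rat_lift dom0 big_nil. Qed.

Lemma rat_liftZ c m : rat_lift (c *: m) = (ratr c : F) *: rat_lift m.
Proof.
rewrite (@rat_liftE (dom m)) ?uniq_dom//; last exact: domZ_subset.
by rewrite scaler_sumr; apply: eq_bigr => k _; rewrite coeffZ rmorphM scalerA.
Qed.

Lemma rat_liftU k : rat_lift << k >> = h k.
Proof.
by rewrite /rat_lift domU1 big_seq1 coeffU eqxx mulr1 rmorph1 scale1r.
Qed.

Lemma rat_lift_sum (I : Type) (r : seq I) (f : I -> {freeg K / rat}) :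
  rat_lift (\sum_(i <- r) f i) = \sum_(i <- r) rat_lift (f i).
Proof. exact: (big_morph _ rat_liftD rat_lift0). Qed.

End FreeModules.

(** * The dimension of a weighted cover *)

Section WeightedCover.
Variables (G : groupType) (T : rset G).

Definition transporter (s t : T) : set G := [set g | ract s g = t].

Definition mass (A : set G) : rat := (#|` fset_set A|)%:R.

(** The G-translates of the points s_i, each carrying the weight w_i, cover
    every t with total weight 1. *)
Definition weighted_cover (I : finType) (s : I -> T) (w : I -> rat) :=
  (forall i t, finite_set (transporter (s i) t)) /\
  (forall t, \sum_i w i * mass (transporter (s i) t) = 1).

(** The total weight is the sum over the orbits of 1 / |isotropy|. *)
Definition has_mass (d : rat) :=
  exists (I : finType) (s : I -> T) (w : I -> rat),
    weighted_cover s w /\ \sum_i w i = d.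

Lemma has_mass_ord d : has_mass d ->
  exists n (s : 'I_n -> T) (w : 'I_n -> rat),
    weighted_cover s w /\ \sum_i w i = d.
Proof.
move=> [I [s [w [[fin_s sum_s] <-]]]].
exists #|I|, (s \o enum_val), (w \o enum_val); split; last first.
  by rewrite [RHS](reindex _ (onW_bij _ (enum_val_bij I))).
split=> [i t|t]; first exact: fin_s.
by rewrite -(sum_s t) [RHS](reindex _ (onW_bij _ (enum_val_bij I))).
Qed.

End WeightedCover.

Section CoverDimension.
Variables (R : realType) (G : groupType) (T : rset G).
Variables (n : nat) (s : 'I_n -> T) (w : 'I_n -> rat).
Hypothesis cover_sw : weighted_cover s w.

Local Notation QG := {freeg G / rat}.
Local Notation QT := {freeg {classic T} / rat}.
Local Notation N := (vN R G).
Local Notation tensor := (tensor R T).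
Local Notation U t := (<< (t : {classic T}) >> : QT).

Lemma vN_of_QGE : @vN_of_QG R G = rat_lift (@vN_of R G).
Proof. by []. Qed.

Lemma vN_scaleAl (c : R[i]) (a b : N) : c *: (a * b) = (c *: a) * b.
Proof. by apply: vN_eq. Qed.

Lemma vN_scaleAr (c : R[i]) (a b : N) : c *: (a * b) = a * (c *: b).
Proof. by apply: vN_eq => v; rewrite -[RHS]/(a (c *: b v)) vNZ. Qed.

Lemma vN_ofM (g h : G) : vN_of R (g * h)%g = vN_of R g * vN_of R h.
Proof.
by apply: vN_eq => v; apply: val_inj; apply/funext => x /=; rewrite mulgA.
Qed.

Lemma vN_trace_of (g : G) : vN_trace (vN_of R g) = (g == 1%g)%:R.
Proof. by rewrite /vN_trace /= mul1g. Qed.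

Lemma qractD (m m' : QT) (r : QG) : qract (m + m') r = qract m r + qract m' r.
Proof. exact: fgliftD. Qed.

Lemma qractZ c (m : QT) (r : QG) : qract (c *: m) r = c *: qract m r.
Proof. exact: fgliftZ. Qed.

Lemma qractU t (r : QG) : qract (U t) r = fglift (fun g => U (ract t g)) r.
Proof. exact: fgliftU. Qed.

(** The i-th component of the section of N^n -> QT (x) N; it is taken on QT
    alone, the factor a of t (x) a being multiplied on the right. *)
Definition cover_coef i : QT -> N := rat_lift (fun t : {classic T} =>
  (ratr (w i) : R[i]) *: \sum_(g <- fset_set (transporter (s i) t)) vN_of R g).

Lemma cover_coefD i m m' :
  cover_coef i (m + m') = cover_coef i m + cover_coef i m'.
Proof. exact: rat_liftD. Qed.

Lemma cover_coefZ i c m :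
  cover_coef i (c *: m) = (ratr c : R[i]) *: cover_coef i m.
Proof. exact: rat_liftZ. Qed.

Lemma cover_coef0 i : cover_coef i 0 = 0.
Proof. exact: rat_lift0. Qed.

Lemma transporterM i t h g :
  transporter (s i) (ract t h) g <-> transporter (s i) t (g * h^-1)%g.
Proof.
rewrite /transporter /=; rewrite ractM; split=> [->|<-].
  by rewrite -ractM mulgV ract1.
by rewrite -ractM mulVg ract1.
Qed.

Lemma cover_coef_ract i t h :
  cover_coef i (U (ract t h)) = cover_coef i (U t) * vN_of R h.
Proof.
have [fin_s _] := cover_sw.
rewrite /cover_coef !rat_liftU -vN_scaleAl mulr_suml; congr (_ *: _).
under [RHS]eq_bigr do rewrite -vN_ofM.
rewrite -[RHS](big_map (fun g => (g * h)%g) predT (@vN_of R G)).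
apply: perm_big.
apply: uniq_perm; rewrite ?map_inj_uniq ?fset_uniq//; first exact: mulIg.
move=> g; rewrite in_fset_set//; apply/idP/mapP => [/set_mem/transporterM gt|].
  by exists (g * h^-1)%g; rewrite ?mulgVK// in_fset_set//; exact/mem_set.
move=> [k]; rewrite in_fset_set// => /set_mem kt ->; apply/mem_set.
by apply/transporterM; rewrite mulgK.
Qed.

(** This equivariance is what makes the section descend to the tensor product
    over QG. *)
Lemma cover_coefM i m r :
  cover_coef i (qract m r) = cover_coef i m * vN_of_QG R r.
Proof.
rewrite vN_of_QGE.
elim/freeg_ind: m => [|c t m IH].
  by rewrite /qract fglift0 cover_coef0 mul0r.
rewrite qractD qractZ qractU !cover_coefD IH mulrDl.
congr (_ + _); rewrite !cover_coefZ -vN_scaleAl; congr (_ *: _).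
clear IH; elim/freeg_ind: r => [|c' g r IHr].
  by rewrite fglift0 cover_coef0 rat_lift0 mulr0.
rewrite fglift_linear fgliftU cover_coefD cover_coefZ rat_liftD rat_liftZ.
by rewrite IHr mulrDr -vN_scaleAr cover_coef_ract rat_liftU.
Qed.

(** The section before passing to the tensor product; [zmodule] supplies the
    scalar action of int. *)
Definition cover_vec (z : {freeg (QT * N)%type / int}) : 'cV[N]_n :=
  fglift (fun p : QT * N =>
    (\col_i (cover_coef i p.1 * p.2) : zmodule 'cV[N]_n)) z.

Lemma cover_vecB z z' : cover_vec (z - z') = cover_vec z - cover_vec z'.
Proof.
exact: (@lift_is_additive int _ (zmodule 'cV[N]_n : lmodType int) _ z z').
Qed.

Lemma cover_vec0 : cover_vec 0 = 0.
Proof. by have := cover_vecB 0 0; rewrite !subrr. Qed.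

Lemma cover_vecU m a : cover_vec << (m, a) >> = \col_i (cover_coef i m * a).
Proof. by rewrite /cover_vec liftU scale1r. Qed.

Lemma cover_vec_rel z : tensor_rel z -> cover_vec z = 0.
Proof.
have vecU i m a : cover_vec << (m, a) >> i 0 = cover_coef i m * a.
  by rewrite cover_vecU mxE.
have vecB i y y' : cover_vec (y - y') i 0 = cover_vec y i 0 - cover_vec y' i 0.
  by rewrite cover_vecB mxE [X in _ + X]mxE.
elim=> [m m' a|m a a'|m r a||y y' _ Hy _ Hy'].
- apply/colP => i; rewrite !vecB !vecU [RHS]mxE cover_coefD.
  by rewrite (mulrDl (cover_coef i m)) -addrA -opprD subrr.
- apply/colP => i; rewrite !vecB !vecU [RHS]mxE.
  by rewrite (mulrDr (cover_coef i m)) -addrA -opprD subrr.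
- apply/colP => i; rewrite !vecB !vecU [RHS]mxE.
  by rewrite cover_coefM mulrA subrr.
- exact: cover_vec0.
- by rewrite cover_vecB Hy Hy' subrr.
Qed.

Definition tens (m : QT) (a : N) : tensor := tensor_pi << (m, a) >>.

Lemma tensDl m m' a : tens (m + m') a = tens m a + tens m' a.
Proof.
rewrite -tensor_piD; apply/tensor_piP; rewrite opprD addrA; exact: TensorRelDl.
Qed.

Lemma tensDr m a a' : tens m (a + a') = tens m a + tens m a'.
Proof.
rewrite -tensor_piD; apply/tensor_piP; rewrite opprD addrA; exact: TensorRelDr.
Qed.

Lemma tensM m r a : tens (qract m r) a = tens m (vN_of_QG R r * a).
Proof. by apply/tensor_piP; exact: TensorRelM. Qed.

Lemma tensZ (b : N^c) m a : b *: tens m a = tens m ((a : N) * b).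
Proof. by rewrite -[LHS]/(tensor_mulr b _) tensor_mulrE free_mulrU. Qed.

Lemma tens0l a : tens 0 a = 0.
Proof. by apply: (addrI (tens 0 a)); rewrite -tensDl !addr0. Qed.

Lemma tens_suml (I : Type) (r : seq I) F a :
  tens (\sum_(i <- r) F i) a = \sum_(i <- r) tens (F i) a.
Proof.
by apply: (big_morph (tens^~ a)) => [m m'|]; rewrite ?tensDl ?tens0l.
Qed.

Definition uncover (v : 'cV[N]_n) : tensor := \sum_i tens (U (s i)) (v i 0).

Lemma uncover_linear : right_linear uncover.
Proof.
split=> [u v|v a].
  by rewrite /uncover -big_split; apply: eq_bigr => i _; rewrite mxE tensDr.
rewrite /uncover scaler_sumr; apply: eq_bigr => i _.
by rewrite mxE big_ord1 !mxE eqxx mulr1n tensZ.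
Qed.

Lemma uncoverB u v : uncover (u - v) = uncover u - uncover v.
Proof.
have [uD _] := uncover_linear.
by apply: (addIr (uncover v)); rewrite -uD !subrK.
Qed.

(** For m = t the coefficients move across the tensor sign onto s_i, where each
    g with s_i g = t yields t; what remains is t (x) a times the weighted number
    of such g, which is 1. *)
Lemma cover_coef_tens m a :
  \sum_i tens (U (s i)) (cover_coef i m * a) = tens m a.
Proof.
have [fin_s sum_s] := cover_sw.
elim/freeg_ind: m => [|c t m IH].
  rewrite tens0l big1// => i _; rewrite cover_coef0 mul0r.
  by apply: (addrI (tens (U (s i)) 0)); rewrite -tensDr !addr0.
pose r i : QG :=
  (c * w i) *: \sum_(g <- fset_set (transporter (s i) t)) << g >>.
have coefE i : cover_coef i (c *: U t) = vN_of_QG R (r i).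
  rewrite /cover_coef vN_of_QGE !rat_liftZ rat_liftU rat_lift_sum scalerA.
  rewrite rmorphM.
  by congr (_ *: _); apply: eq_bigr => g _; rewrite rat_liftU.
have qractE i : qract (U (s i)) (r i) =
    c *: ((w i * mass (transporter (s i) t)) *: U t).
  rewrite qractU /r fgliftZ fglift_sum -!scalerA; congr (_ *: (_ *: _)).
  rewrite (eq_big_seq (fun=> U t)) => [|g].
    by rewrite big_const_seq count_predT iter_addr_0 scaler_nat.
  by rewrite fgliftU in_fset_set// => /set_mem <-.
have tE : c *: U t = \sum_i qract (U (s i)) (r i).
  under eq_bigr do rewrite qractE.
  by rewrite -scaler_sumr -scaler_suml sum_s scale1r.
rewrite tensDl -IH {2}tE tens_suml -big_split; apply: eq_bigr => i _.
rewrite cover_coefD mulrDl tensDr coefE.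
by rewrite tensM.
Qed.

Lemma uncoverK z : uncover (cover_vec z) = tensor_pi z.
Proof.
elim/free_ind: z => [|[m a]|z z' IH IH'].
- rewrite cover_vec0; have := uncoverB 0 0; rewrite !subrr => ->.
  by have := tensor_piB (0 : {freeg (QT * N)%type / int}) 0; rewrite !subrr.
- rewrite cover_vecU -[RHS]/(tens m a) -cover_coef_tens.
  by apply: eq_bigr => i _; rewrite mxE.
- by rewrite cover_vecB uncoverB tensor_piB IH IH'.
Qed.

Definition cover_mx : 'M[N]_n := \matrix_(i, j) cover_coef i (U (s j)).

Lemma cover_vec_sum (I : Type) (r : seq I) F :
  cover_vec (\sum_(i <- r) F i) = \sum_(i <- r) cover_vec (F i).
Proof.
have vD z z' : cover_vec (z + z') = cover_vec z + cover_vec z'.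
  by apply: (addIr (- cover_vec z')); rewrite -cover_vecB !addrK.
exact: (big_morph cover_vec vD cover_vec0).
Qed.

(** [cover_mx] is the matrix of [cover_vec] after [uncover]; the class
    [uncover v] is lifted to the free group since [cover_vec] lives there. *)
Lemma cover_mxE v :
  exists2 z, uncover v = tensor_pi z & cover_vec z = cover_mx *m v.
Proof.
exists (\sum_j << (U (s j), v j 0) >>).
  rewrite /uncover.
  rewrite (big_morph (@tensor_pi R G T) (@tensor_piD R G T) (id1 := 0))//.
  by have := tensor_piB (0 : {freeg (QT * N)%type / int}) 0; rewrite !subrr.
rewrite cover_vec_sum; apply/colP => i; rewrite summxE mxE.
apply: eq_bigr => j _.
by rewrite cover_vecU !mxE.
Qed.

(** Since [uncover] has a section, [cover_mx] is idempotent with image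
    isomorphic to the tensor product; on its diagonal only g = 1 contributes to
    the trace. *)
Lemma fgproj_dim_cover :
  fgproj_dim (tensor : lmodType N^c) (ratr (\sum_i w i)).
Proof.
exists n, cover_mx, uncover.
have coverK v : uncover (cover_mx *m v) = uncover v.
  by have [z -> <-] := cover_mxE v; exact: uncoverK.
have coverE u v : uncover u = uncover v -> cover_mx *m u = cover_mx *m v.
  have [y -> <-] := cover_mxE u; have [z -> <-] := cover_mxE v.
  move=> /tensor_piP/cover_vec_rel; rewrite cover_vecB => /eqP.
  by rewrite subr_eq0 => /eqP.
have idem : cover_mx *m cover_mx = cover_mx.
  by apply: mulmx_ext => v; rewrite -mulmxA; apply: coverE; rewrite coverK.
have [fin_s sum_s] := cover_sw.
split=> //; [|exact: uncover_linear|].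
- under [in RHS]eq_bigr => i _.
    rewrite mxE /cover_coef rat_liftU -[vN_trace _]/(ratr (w i) * vN_trace _).
    rewrite vN_trace_sum (big_fsetD1 1%g)/=; last first.
      by rewrite in_fset_set//; apply/mem_set; exact: ract1.
    rewrite vN_trace_of eqxx big_seq big1 => [|g]; last first.
      by rewrite !inE vN_trace_of => /andP[/negPf->].
    rewrite addr0 mulr1; over.
  have -> : \sum_i ratr (w i) = (ratr (\sum_i w i) : R)%:C%C :> R[i].
    by rewrite [RHS]fmorph_rat rmorph_sum.
  by [].
- split=> [//|u v|x _].
    move=> /set_mem[u' _ <-] /set_mem[v' _ <-]; rewrite !coverK.
    exact: coverE.
  elim/tensor_ind: x => z; exists (cover_mx *m cover_vec z).
    by exists (cover_vec z).
  by rewrite coverK uncoverK.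
Qed.

End CoverDimension.

Lemma rset_rdim_mass (R : realType) (G : groupType) (T : rset G) d :
  has_mass T d -> rset_rdim R T = d.
Proof.
move=> /has_mass_ord[n [s [w [cover_sw <-]]]].
apply: rset_rdimE; exact: (fgproj_dim_cover R cover_sw).
Qed.

(** * Weighted covers of proper cofinite sets and of balanced products *)

Section Mass.

Lemma mass_sum (T : choiceType) (F : {fset T}) :
  (#|` F|)%:R = \sum_(x <- F) 1 :> rat.
Proof. by rewrite big_const_seq count_predT iter_addr_0. Qed.

Variable G : groupType.
Implicit Types A : set G.

Lemma mass_bigcup (H : groupType) (D : set H) (F : H -> set G) :
  finite_set D -> (forall h, D h -> finite_set (F h)) -> trivIset D F ->
  mass (\bigcup_(h in D) F h) = \sum_(h <- fset_set D) mass (F h).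
Proof.
move=> finD finF trivF; have finU := bigcup_finite finD finF.
rewrite /mass; under eq_bigr do rewrite mass_sum.
have finF' h : h \in fset_set D -> finite_set (F h).
  by rewrite in_fset_set// => /set_mem/finF.
rewrite -partition_disjoint_bigfcup => [|h k hD kD hk].
  rewrite mass_sum; congr (\sum_(x <- _) 1); congr enum_fset; apply/fsetP => g.
  rewrite in_fset_set//; apply/idP/bigfcupP => [/set_mem[h Dh Fhg]|[h]].
    have hD : h \in fset_set D by rewrite in_fset_set//; apply/mem_set.
    by exists h; rewrite ?hD// in_fset_set; [exact/mem_set|exact: finF'].
  rewrite andbT => hD; rewrite in_fset_set; last exact: finF'.
  move=> /set_mem Fhg; apply/mem_set; exists h => //.
  by move: hD; rewrite in_fset_set// => /set_mem.
apply/fdisjointP => g; rewrite (in_fset_set (finF' _ hD)) => /set_mem Fhg.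
rewrite (in_fset_set (finF' _ kD)).
apply: contra hk => /set_mem Fkg; apply/eqP; apply: trivF.
- by move: hD; rewrite in_fset_set// => /set_mem.
- by move: kD; rewrite in_fset_set// => /set_mem.
- by exists g.
Qed.

Lemma mass_image (f : G -> G) A : injective f -> finite_set A ->
  mass (f @` A) = mass A.
Proof.
by move=> f_inj finA; rewrite /mass fset_set_image// card_imfset.
Qed.

Lemma mass0 : mass (set0 : set G) = 0.
Proof. by rewrite /mass fset_set0 cardfs0. Qed.

Lemma mass_gt0 A g : finite_set A -> A g -> 0 < mass A.
Proof.
move=> finA Ag; rewrite ltr0n cardfs_gt0; apply/fset0Pn; exists g.
by rewrite in_fset_set//; exact/mem_set.
Qed.

End Mass.

Section Orbits.
Variables (G : groupType) (T : rset G).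
Implicit Types s t : T.

Lemma rorbit_ract t h : rorbit (ract t h) = rorbit t.
Proof.
apply/seteqP; split=> [_ [g _ <-]|_ [g _ <-]].
  by exists (h * g)%g; rewrite ?ractM.
by exists (h^-1 * g)%g; rewrite // -ractM mulVKg.
Qed.

Lemma transporter_translate s h :
  transporter s (ract s h) = (fun g => g * h)%g @` isotropy s.
Proof.
apply/seteqP; split=> [g /= sg|_ [g /= sg <-]]; last first.
  by rewrite /transporter /= ractM sg.
exists (g * h^-1)%g; last by rewrite mulgVK.
by rewrite /isotropy /= ractM sg -ractM mulgV ract1.
Qed.

Lemma transporter_proper :
  rset_proper T -> forall s t, finite_set (transporter s t).
Proof.
move=> propT s t; case: (pselect (transporter s t !=set0)) => [[h <-]|].
  by rewrite transporter_translate; apply: finite_image; exact: propT.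
by move=> /set0P/negP/negPn/eqP ->; exact: finite_set0.
Qed.

(** One representative of each orbit, weighted by 1 / |isotropy|: only the
    representative of the orbit of t reaches t, along a coset of its isotropy
    group. *)
Lemma has_mass_proper_cofinite : rset_proper T -> rset_cofinite T ->
  exists d, has_mass T d.
Proof.
move=> propT cofT; pose I := fset_set (range (@rorbit G T)).
have /choice[s sE] : forall i : I, exists t, rorbit t = val i.
  move=> i; have := valP i; rewrite in_fset_set// => /set_mem[t _ <-].
  by exists t.
exists (\sum_i (mass (isotropy (s i)))^-1), I, s,
  (fun i => (mass (isotropy (s i)))^-1).
split=> //; split=> [i t|t]; first exact: transporter_proper.
have tI : rorbit t \in I by rewrite in_fset_set//; apply/mem_set; exists t.
pose i0 : I := [` tI]%fset.
rewrite (bigD1 i0)//= [X in _ + X]big1 => [|i i_i0]; last first.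
  rewrite (_ : transporter _ _ = set0) ?mass0 ?mulr0//.
  apply/seteqP; split=> // g /= sg; move/eqP: i_i0; apply.
  by apply: val_inj; rewrite -sE -(rorbit_ract _ g) sg.
have [h _ <-] : rorbit (s i0) t by rewrite sE; exists 1%g; rewrite ?ract1.
rewrite addr0 transporter_translate mass_image//; last exact: mulIg.
rewrite mulVf// gt_eqF//; apply: (mass_gt0 (propT _) (g := 1%g)); exact: ract1.
Qed.

End Orbits.

Section BalancedMass.
Variables (K H G : groupType) (S : biset K H) (T : biset H G).
Hypothesis free_T : forall h (t : T), lact h t = t -> h = 1%g.

(** The elements k record the ambiguity (s, t) ~ (s k^-1, k t) of a
    representative. *)
Lemma transporter_bprod (s s0 : S) (t t0 : T) :
  transporter (T := bprod S T) (bprod_pi s t) (bprod_pi s0 t0) =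
  \bigcup_(k in transporter s s0) transporter t (lact k t0).
Proof.
apply/seteqP; split=> [g|g [k /= sk tg]].
  rewrite /transporter /= => /(etrans (esym (bprod_ractE _ _ _)))/bprod_piP.
  move=> [h [sh t0h]]; exists h^-1%g; rewrite /transporter /=.
    by rewrite sh -ractM mulgV ract1.
  by rewrite t0h -lactM mulVg lact1.
apply: etrans (bprod_ractE _ _ _) _; apply/bprod_piP; exists k^-1%g.
by rewrite tg -lactM mulVg lact1 -sk -ractM mulgV ract1.
Qed.

(** Freeness makes the union in [transporter_bprod] disjoint, so the count over
    pairs is a double sum: summing over j first gives 1 for each k, and then
    summing over i gives 1. *)
Lemma has_mass_bprod c d :
  has_mass S c -> has_mass T d -> has_mass (bprod S T) (c * d).
Proof.
move=> [I [s [w [[fin_s sum_s] <-]]]] [J [t [v [[fin_t sum_t] <-]]]].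
exists (I * J)%type, (fun p => bprod_pi (s p.1) (t p.2)),
  (fun p => w p.1 * v p.2).
split; last first.
  by rewrite big_distrlr /= pair_bigA.
have fin_st i j s0 t0 : finite_set (transporter (T := bprod S T)
    (bprod_pi (s i) (t j)) (bprod_pi s0 t0)).
  by rewrite transporter_bprod; apply: bigcup_finite => // k _.
split=> [[i j] p|p]; rewrite -(bprod_reprK p) //.
set s0 := (repr p).1; set t0 := (repr p).2.
rewrite -(sum_s s0) -(pair_bigA _ (fun i j => w i * v j * mass
  (transporter (T := bprod S T) (bprod_pi (s i) (t j)) (bprod_pi s0 t0)))) /=.
apply: eq_bigr => i _.
rewrite [mass (transporter (s i) _)]mass_sum big_distrr /=.
under [RHS]eq_bigr => k _.
  rewrite -(sum_t (lact k t0)) big_distrr; over.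
rewrite exchange_big; apply: eq_bigr => j _ /=.
rewrite transporter_bprod mass_bigcup//; last first.
  move=> h k _ _ [g [/= tg tg']]; apply: (mulgI k^-1%g); rewrite mulVg.
  apply: (free_T (t := t0)).
  by rewrite lactM -tg tg' -lactM mulVg lact1.
by rewrite big_distrr; apply: eq_bigr => k _; rewrite /= mulrA.
Qed.

End BalancedMass.

(** * Inversion of locally unipotent maps *)

Section LinearExtension.
Variables (A : nzRingType) (K : choiceType) (M : lmodType A).

Lemma freeg_linear_ext (f g : {linear {freeg K / A} -> M}) :
  (forall k, f << k >> = g << k >>) -> f =1 g.
Proof.
move=> fg; elim/freeg_ind => [|c k m IH]; first by rewrite !linear0.
by rewrite !linearP IH fg.
Qed.

End LinearExtension.

Section Neumann.
Variables (A : nzRingType) (V : lmodType A) (nu : {linear V -> V}).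

Lemma neumann_telescope L u :
  let S := \sum_(l < L) (-1) ^+ l *: iter l nu u in
  S + nu S = u - (-1) ^+ L *: iter L nu u.
Proof.
elim: L => [|L IH] /=.
  by rewrite big_ord0 linear0 addr0 expr0 scale1r subrr.
have nuZ c v : nu (c *: v) = c *: nu v by rewrite linearZ.
rewrite big_ord_recr /= linearD addrACA IH nuZ.
by rewrite exprS mulN1r scaleNr opprK addrA subrK.
Qed.

(** On the kernel of 1 + nu the map nu acts as -1, which cannot be nilpotent at
    a nonzero vector. *)
Lemma nilpotent_inj u L : iter L nu u = 0 -> u + nu u = 0 -> u = 0.
Proof.
move=> nuL /eqP; rewrite addr_eq0 -linearN => /eqP uE.
suff : forall l, iter l nu u = (-1) ^+ l *: u.
  move=> /(_ L); rewrite nuL => /(congr1 (fun v => (-1) ^+ L *: v)).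
  by rewrite scalerA -expr2 sqrr_sign scale1r scaler0.
have nuE : nu u = - u by rewrite [in RHS]uE linearN opprK.
elim=> [|l IH]; first by rewrite expr0 scale1r.
by rewrite iterS IH linearZ /= nuE exprS mulN1r scaleNr scalerN.
Qed.

End Neumann.

(** * Inversion over an EI-category *)

Section EICategory.
Variables (R : realType) (C : category).
Hypotheses (EI_C : EI C) (qf_C : quasi_finite C) (free_C : is_free C).
Local Notation iso := (iso C).
Implicit Types x y z : iso.
Local Notation omega_entry := (@omega_entry C R).

Lemma iso_le_refl x : iso_le x x.
Proof. by apply/asboolP; exists; exact: idm. Qed.

Lemma iso_le_trans : transitive (@iso_le C).
Proof.
move=> y x z /asboolP[f] /asboolP[g]; apply/asboolP; exists; exact: (mcomp g f).
Qed.

(** Morphisms f and g in opposite directions have invertible composites, so f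
    has a left and a right inverse. *)
Lemma iso_le_anti : antisymmetric (@iso_le C).
Proof.
move=> x y /andP[/asboolP[f] /asboolP[g]]; rewrite -[x]reprK -[y]reprK.
apply/eqmodP/asboolP; exists f.
have [h [hgf _]] := EI_C (mcomp g f); have [k [_ fgk]] := EI_C (mcomp f g).
have hgE : mcomp h g = mcomp g k.
  rewrite -[mcomp h g]compm1 -fgk -!Defs.compA (Defs.compA g f).
  by rewrite (Defs.compA h) hgf comp1m.
exists (mcomp h g); split; first by rewrite -Defs.compA.
by rewrite hgE Defs.compA.
Qed.

Lemma iso_lt_irr : irreflexive (@iso_lt C).
Proof. by move=> x; rewrite /iso_lt eqxx. Qed.

Lemma iso_lt_trans : transitive (@iso_lt C).
Proof.
move=> y x z /andP[xy le_xy] /andP[_ le_yz].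
rewrite /iso_lt (iso_le_trans le_xy le_yz) andbT.
by apply: contra xy => /eqP xz; apply/eqP/iso_le_anti; rewrite le_xy xz.
Qed.

Lemma has_mass_mor x y : has_mass (mor_biset (rep y) (rep x)) (omega_entry x y).
Proof.
have [propT cofT] := qf_C.2 (rep y) (rep x).
have [d Td] := has_mass_proper_cofinite propT cofT.
by rewrite /omega_entry (rset_rdim_mass R Td).
Qed.

(** By the EI property mor(a, a) = aut(a), a single free orbit. *)
Lemma has_mass_aut (a : C) : has_mass (mor_biset a a) 1.
Proof.
exists unit, (fun=> idm a), (fun=> 1).
have tE (t : mor_biset a a) :
    transporter (T := mor_biset a a) (idm a) t = [set Aut (EI_C t)].
  apply/seteqP; split=> [g|_ ->]; rewrite /transporter /= /mor_ract comp1m//.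
  by move=> gt; apply: aut_inj.
split; last by rewrite big_const card_unit.
split=> [_ t|t]; first by rewrite tE; exact: finite_set1.
by rewrite big_const card_unit /= tE /mass fset_set1 cardfs1 mul1r addr0.
Qed.

Lemma omega_entry_diag x : omega_entry x x = 1.
Proof. exact: rset_rdim_mass (has_mass_aut (rep x)). Qed.

Lemma omega_entry_le x y : omega_entry x y != 0 -> iso_le y x.
Proof.
apply: contraR => /asboolP nle; apply/eqP/rset_rdim_mass.
(* Without a morphism the empty family is a cover. *)
exists void, (@of_void _), (@of_void _).
split; last by rewrite big_pred0// => -[].
by split=> [[]|t]; case: nle; exists.
Qed.

Fixpoint chain_weight y (c : seq iso) : rat :=
  if c is x1 :: c' then chain_weight x1 c' * omega_entry x1 y else 1.

Lemma has_mass_chain y c : has_mass (chain_biset y c) (chain_weight y c).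
Proof.
elim: c y => [|x1 c IH] y /=; first exact: has_mass_aut.
case: c IH => [|x2 c] IH; first by rewrite mul1r; exact: has_mass_mor.
apply: has_mass_bprod; [exact: free_C|exact: (IH x1)|exact: has_mass_mor].
Qed.

Definition lower x : {fset iso} := fset_set [set y | iso_le y x].

Lemma mem_lower x y : (y \in lower x) = iso_le y x.
Proof. by rewrite in_fset_set ?mem_setE//; exact: qf_C.1. Qed.

(** The chains of length l as a finite set: a sum over [chain] is a genuine sum
    only once that set is known to be finite. *)
Fixpoint chains l y x : {fset (seq iso)} :=
  if l is l'.+1 then
    (\bigcup_(z <- lower x)
      if iso_lt y z then [fset z :: c | c in chains l' z x] else fset0)%fset
  else if y == x then [fset [::]]%fset else fset0.

Lemma path_le_last y c : path (@iso_lt C) y c ->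
  {in y :: c, forall z, iso_le z (last y c)}.
Proof.
elim: c y => [|x c IH] y /=.
  by move=> _ z; rewrite inE => /eqP->; exact: iso_le_refl.
move=> /andP[/andP[_ yx] xc] z; rewrite inE => /predU1P[->|]; last exact: IH.
by apply: iso_le_trans yx (IH _ xc _ _); rewrite inE eqxx.
Qed.

Lemma chainsE l y x : chain l y x = [set` chains l y x].
Proof.
apply/seteqP; split=> c.
  elim: l y c => [|l IH] y [|z c] [yc sz lst] //=; move: yc sz lst => /=.
    by move=> _ _ ->; rewrite eqxx inE.
  move=> /andP[yz zc] [sz] lst; apply/bigfcupP; exists z.
    by rewrite mem_lower andbT -lst; apply: path_le_last; rewrite // inE eqxx.
  by rewrite yz; apply/imfsetP; exists c => //=; exact: IH.
elim: l y c => [|l IH] y c /=.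
  by case: eqP => // -> ; rewrite inE => /eqP ->.
move=> /bigfcupP[z _]; case: ifP => // yz /imfsetP[d /= /IH[zd sz lst] ->].
by split; rewrite /= ?yz ?sz.
Qed.

Definition chain_sum l x y : rat := \sum_(c <- chains l y x) chain_weight y c.

Lemma chain_sumE l x y :
  \sum_(c \in chain l y x) rset_rdim R (chain_biset y c) = chain_sum l x y.
Proof.
rewrite chainsE -fsbig_seq ?fset_uniq//; apply: eq_bigr => c _.
exact: rset_rdim_mass (has_mass_chain y c).
Qed.

(** A chain below x has no repetition, so its length is bounded by the size of
    the lower set of x. *)
Lemma chain_sum_eq0 l x y : ~~ iso_le y x || (#|` lower x| < l)%N ->
  chain_sum l x y = 0.
Proof.
move=> yxl; rewrite /chain_sum big_seq big1// => c cl; exfalso.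
have [yc sz lst] : chain l y x c by rewrite chainsE.
move: yxl; have c_le := path_le_last yc; rewrite -lst c_le ?mem_head//= lst.
rewrite ltnNge -sz uniq_leq_size//.
  by apply: sorted_uniq iso_lt_trans iso_lt_irr _ _; exact: path_sorted yc.
by move=> z zc; rewrite mem_lower -lst; apply: c_le; rewrite inE zc orbT.
Qed.

(** The matrix of omega - 1. *)
Definition strict_entry x y : rat := if iso_lt y x then omega_entry x y else 0.

(** Chains are split at their first step, as the weights are. *)
Lemma chain_sumS l x y :
  chain_sum l.+1 x y = \sum_(z <- lower x) chain_sum l x z * strict_entry z y.
Proof.
rewrite /chain_sum /= partition_disjoint_bigfcup => [|z z' _ _ zz']; last first.
  apply/fdisjointP => c; case: ifP => // _; case: ifP => // _.
  by move=> /imfsetP[d _ ->]; apply: contra zz' => /imfsetP[d' _ [->]].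
apply: eq_bigr => z _; rewrite /strict_entry; case: ifP => yz; last first.
  by rewrite mulr0 big_seq_fset0.
rewrite big_imfset => [|c c' _ _ []//] /=.
by rewrite big_distrl.
Qed.

Local Notation UQ := (UQ C).
Local Notation gen x := (<< x >> : UQ).

Lemma matrix_homE W x (A : {fset iso}) : (forall y, y \notin A -> W x y = 0) ->
  matrix_hom W (gen x) = \sum_(y <- A) W x y *: gen y.
Proof.
move=> WA; rewrite /matrix_hom fgliftU; apply: fsbigTE => y /WA ->.
exact: scale0r.
Qed.

Lemma lower0 x y : y \notin lower x -> ~~ iso_le y x.
Proof. by rewrite mem_lower. Qed.

Definition nu : {linear UQ -> UQ} := matrix_hom strict_entry.

Lemma nuE x (A : {fset iso}) : {subset lower x <= A} ->
  nu (gen x) = \sum_(y <- A) strict_entry x y *: gen y.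
Proof.
move=> xA; apply: matrix_homE => y yA; rewrite /strict_entry /iso_lt.
rewrite -mem_lower; case: (boolP (y \in _)) => [/xA|_]; last by rewrite andbF.
by rewrite (negPf yA).
Qed.

Lemma sum_diag x : \sum_(y <- lower x) (y == x)%:R *: gen y = gen x.
Proof.
rewrite (big_fsetD1 x) ?mem_lower ?iso_le_refl//= eqxx scale1r.
rewrite big_seq big1 ?addr0// => y; rewrite !inE => /andP[/negPf-> _].
exact: scale0r.
Qed.

Lemma omegaE u : omega C R u = u + nu u.
Proof.
pose f : {linear UQ -> UQ} := idfun \+ nu.
rewrite -[RHS]/(f u); apply: freeg_linear_ext => x.
rewrite -[RHS]/(gen x + nu (gen x)) (nuE (A := lower x))// -{2}(sum_diag x).
rewrite [LHS](matrix_homE (A := lower x)) => [|y /lower0]; last first.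
  by apply: contraNeq; exact: omega_entry_le.
rewrite -big_split big_seq [RHS]big_seq; apply: eq_bigr => y /=.
rewrite mem_lower -scalerDl /strict_entry /iso_lt => ->.
by case: eqP => [->|_]; rewrite ?omega_entry_diag ?addr0 ?add0r.
Qed.

Lemma iter_nu l x :
  iter l nu (gen x) = \sum_(y <- lower x) chain_sum l x y *: gen y.
Proof.
elim: l => [|l IH].
  rewrite /= -[LHS]sum_diag; apply: eq_bigr => y _; rewrite /chain_sum /=.
  by case: eqP => _; rewrite ?big_seq_fset1 ?big_seq_fset0.
rewrite iterS IH linear_sum /=.
have zx z : z \in lower x -> {subset lower z <= lower x}.
  by rewrite mem_lower => zx y; rewrite !mem_lower => /iso_le_trans; apply.
under [RHS]eq_bigr do rewrite chain_sumS scaler_suml.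
rewrite exchange_big big_seq [RHS]big_seq; apply: eq_bigr => z /zx zx' /=.
rewrite linearZ /= (nuE zx') scaler_sumr.
by apply: eq_bigr => y _; rewrite scalerA.
Qed.

Lemma iter_nu_eq0 l x : (#|` lower x| < l)%N -> iter l nu (gen x) = 0.
Proof.
move=> xl; rewrite iter_nu big1// => y _; rewrite chain_sum_eq0 ?scale0r//.
by rewrite xl orbT.
Qed.

Lemma nu_nilpotent u : exists L, forall l, (L < l)%N -> iter l nu u = 0.
Proof.
have nuP l c v v' : iter l nu (c *: v + v') = c *: iter l nu v + iter l nu v'.
  by elim: l => // l IH; rewrite !iterS IH linearP.
elim/freeg_ind: u => [|c x u [L IH]].
  by exists 0%N => l _; elim: l => // l IH; rewrite iterS IH linear0.
exists (maxn #|` lower x| L) => l; rewrite gtn_max => /andP[xl Ll].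
by rewrite nuP iter_nu_eq0// IH// scaler0 addr0.
Qed.

Lemma muE x : mu C R (gen x) =
  \sum_(l < (#|` lower x|).+1) (-1) ^+ l *: iter l nu (gen x).
Proof.
have mu_entryE y : mu_entry R x y =
    \sum_(l < (#|` lower x|).+1) (-1) ^+ l * chain_sum l x y.
  rewrite (fsbig_ord _ _ (fun l => (-1) ^+ l * chain_sum l x y)).
  rewrite [RHS](fsbig_widen _ setT)//.
    by apply: eq_fsbigr => l _; rewrite chain_sumE.
  move=> l [_ /= /negP]; rewrite -leqNgt => xl.
  by rewrite chain_sum_eq0 ?mulr0// xl orbT.
rewrite [LHS](matrix_homE (A := lower x)) => [|y /lower0 yx]; last first.
  by rewrite mu_entryE big1// => l _; rewrite chain_sum_eq0 ?yx ?mulr0.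
under eq_bigr do rewrite mu_entryE scaler_suml.
rewrite exchange_big; apply: eq_bigr => l _; rewrite iter_nu scaler_sumr.
by apply: eq_bigr => y _; rewrite scalerA.
Qed.

Lemma omegaK : cancel (mu C R) (omega C R).
Proof.
move=> u; pose f : {linear UQ -> UQ} := omega C R \o mu C R.
rewrite -[LHS]/(f u) -[RHS]/((idfun : {linear UQ -> UQ}) u).
apply: freeg_linear_ext => x.
by rewrite /f /= omegaE muE neumann_telescope iter_nu_eq0// scaler0 subr0.
Qed.

Lemma omega_inj : injective (omega C R).
Proof.
move=> u v /eqP; rewrite -subr_eq0 -linearB omegaE => /eqP uv0.
have [L /(_ _ (ltnSn L)) nuL] := nu_nilpotent (u - v).
by apply/eqP; rewrite -subr_eq0; apply/eqP; exact: nilpotent_inj nuL uv0.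
Qed.

Lemma muK : cancel (omega C R) (mu C R).
Proof. by move=> u; apply: omega_inj; rewrite omegaK. Qed.

End EICategory.

Theorem theorem6p31 (R : realType) (C : category)
    (EI_C : EI C) (qf_C : quasi_finite C) (free_C : is_free C) :
  [/\ bijective (omega C R), bijective (mu C R),
      cancel (omega C R) (mu C R) & cancel (mu C R) (omega C R)].
Proof.
have oK := omegaK R EI_C qf_C free_C; have mK := muK R EI_C qf_C free_C.
by split=> //; [exists (mu C R)|exists (omega C R)].
Qed.
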